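(* Let $\ell$ be a prime and let $k\geq0$ be an integer. (i) If $\ell$ is odd, then for every $s\geq1$, $$\mathrm{N}_{K(\mu_{\ell^{s+1}})/K(\mu_{\ell^s})}\bigl(c_{\ell^{s+1},k}\bigr)=c_{\ell^s,\ell k}.$$ (ii) Let $m\geq1$ satisfy $\gcd(m,\ell)=1$ and assume that $K\cap\mathbb{Q}(\mu_{m\ell})=\mathbb{Q}$. (a) If $m\geq2$, then $$\mathrm{N}_{K(\mu_{m\ell})/K(\mu_m)}\bigl(c_{m\ell,k}\bigr)=\frac{c_{m,\ell k}}{\sigma_{\ell^{-1}}(c_{m,k})},$$ where $\ell^{-1}$ is the inverse of $\ell$ modulo $m$. (b) If $m=1$, then $\mathrm{N}_{K(\mu_\ell)/K}\bigl(c_{\ell,k}\bigr)=\Phi_\ell(\varepsilon^k)$, where $\Phi_\ell$ is the $\ell$-th cyclotomic polynomial. If $k\geq1$, this may also be written as $$\mathrm{N}_{K(\mu_\ell)/K}\bigl(c_{\ell,k}\bigr)=\frac{c_{1,\ell k}}{c_{1,k}}.$$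
   Context: Let $D>1$ be a square-free integer and $K=\mathbb{Q}(\sqrt D)\subset\overline{\mathbb{Q}}$. Let $u>1$ be the fundamental unit of $K$ (at the real embedding with $\sqrt D>0$), and put $\varepsilon=u$ if $\mathrm{N}_{K/\mathbb{Q}}(u)=1$ and $\varepsilon=u^2$ if $\mathrm{N}_{K/\mathbb{Q}}(u)=-1$. Fix primitive $m$-th roots of unity $\zeta_m\in\overline{\mathbb{Q}}$ for all $m\ge1$ that are power-compatible: $\zeta_{mn}^{\,n}=\zeta_m$ for all $m,n\geq1$. Let $\mu_m$ be the group of $m$-th roots of unity. For $m\geq1$, $k\geq0$ put $c_{m,k}:=1-\zeta_m\varepsilon^k\in K(\mu_m)$. When $K\cap\mathbb{Q}(\mu_m)=\mathbb{Q}$ and $a\in(\mathbb{Z}/m\mathbb{Z})^\times$, $\sigma_a$ denotes the automorphism of $K(\mu_m)/K$ that fixes $K$ and sends $\zeta_m$ to $\zeta_m^a$. $\mathrm N$ denotes the relative field norm. *)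

(* Defs.v *)
From HB Require Import structures.
From mathcomp Require Import all_boot all_order all_algebra all_fingroup all_field.
Set Implicit Arguments.
Unset Strict Implicit.
Unset Printing Implicit Defensive.
Import Order.TTheory GRing.Theory Num.Theory.
Local Open Scope ring_scope.

(* The algebraic closure of Q is algC. Number fields and their relative norms *)
(* live in a finite Galois extension L of Q given with an embedding           *)
(* iota : L -> algC; the subfield K(mu_m) of L is <<K; z>>, where z : L is    *)
(* the preimage of zeta m. Relative norms are MathComp's galNorm, legitimate  *)
(* here because the extensions are Galois (galois_cyclotomic_tower). Such an  *)
(* L exists for all D and m (ambient_field_exists).                           *)

Definition square_free (D : nat) : Prop :=
  forall d : nat, (1 < d)%N -> ~~ (d ^ 2 %| D)%N.

Definition compatible_roots (zeta : nat -> algC) : Prop :=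
  (forall m, (0 < m)%N -> m.-primitive_root (zeta m)) /\
  (forall m n, (0 < m)%N -> (0 < n)%N -> zeta (m * n)%N ^+ n = zeta m).

Section NumberField.

Variables (L : splittingFieldType rat) (iota : {rmorphism L -> algC}).
Implicit Types (K : {subfield L}) (u v z eps : L).

(* As 0^-1 = 0 is an algebraic integer, v != 0 has to be required. *)
Definition integer_unit K v : Prop :=
  [/\ v \in K, v != 0, iota v \in Aint & (iota v)^-1 \in Aint].

(* In algC, 1 < x entails that x is real; the exponent n is an integer. *)
Definition fundamental_unit K u : Prop :=
  [/\ integer_unit K u, 1 < iota u &
      forall v, integer_unit K v -> exists n : int, v = u ^ n \/ v = - u ^ n].

Definition positive_norm_unit K u : L :=
  if galNorm 1 K u == 1 then u else u ^+ 2.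

Definition cyc z eps (k : nat) : L := 1 - z * eps ^+ k.

(* The default 1 is irrelevant when z is a primitive m-th root of unity, a is *)
(* prime to m and K :&: <<1; z>> = 1: see cyc_autP.                           *)
Definition cyc_aut K z (a : nat) : gal_of <<K; z>> :=
  odflt 1%g [pick s : gal_of <<K; z>> in 'Gal(<<K; z>> / K)%g | s z == z ^+ a].

Lemma galois_cyclotomic K (m : nat) z :
  m.-primitive_root z -> galois K <<K; z>>.
Proof.
move=> pz; apply/splitting_galoisField; exists ('X^m - 1); split.
- by rewrite rpredB ?rpred1 ?rpredX //= polyOverX.
- apply: separable_Xn_sub_1; rewrite -(fmorph_eq0 iota) rmorph_nat pnatr_eq0.
  by rewrite -lt0n (prim_order_gt0 pz).
have Dr := factor_Xn_sub_1 pz; rewrite big_mkord in Dr.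
exists (codom (fun i : 'I_m => z ^+ i)); first by rewrite big_image /= Dr eqpxx.
apply/eqP; rewrite eqEsubv; apply/andP; split.
  apply/Fadjoin_seqP; split; first exact: subv_adjoin.
  by move=> _ /codomP[i ->]; rewrite rpredX ?memv_adjoin.
apply/FadjoinP; split; first exact: subv_adjoin_seq.
apply: seqv_sub_adjoin; rewrite -root_prod_XsubC big_image /= Dr.
by apply/unity_rootP/prim_expr_order.
Qed.

Lemma galois_cyclotomic_tower K (m n : nat) z :
  m.-primitive_root z -> galois <<K; z ^+ n>> <<K; z>>.
Proof.
move=> pz; apply: galoisS (galois_cyclotomic K pz); rewrite subv_adjoin /=.
by apply/FadjoinP; rewrite subv_adjoin rpredX ?memv_adjoin.
Qed.

Lemma cyc_autP K (m : nat) z (a : nat) :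
    m.-primitive_root z -> coprime a m -> (K :&: <<1; z>>)%VS = 1%VS ->
  cyc_aut K z a \in 'Gal(<<K; z>> / K)%g /\ cyc_aut K z a z = z ^+ a.
Proof.
move=> pz co_am capK; rewrite /cyc_aut; case: pickP => [s /andP[? /eqP] //|no].
have Dr := factor_Xn_sub_1 pz; rewrite big_mkord in Dr.
set r := codom (fun i : 'I_m => z ^+ i).
have Dr' : 'X^m - 1 = \prod_(y <- r) ('X - y%:P) by rewrite big_image.
have Q1 : minPoly K z \is a polyOver 1%VS.
  rewrite -capK; apply/polyOverP => i; rewrite memv_cap.
  rewrite (polyOverP (minPolyOver K z)) /=.
  have : minPoly K z %| \prod_(y <- r) ('X - y%:P).
    rewrite -Dr'; apply: minPoly_dvdp; last exact/unity_rootP/prim_expr_order.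
    by rewrite rpredB ?rpred1 ?rpredX //= polyOverX.
  case/dvdp_prod_XsubC => b; rewrite eqp_monic ?monic_minPoly ?monic_prod_XsubC //.
  move=> /eqP ->; apply/polyOverP: i; rewrite big_seq; apply: rpred_prod => y.
  move/mem_mask => /codomP[i ->].
  by rewrite polyOverXsubC rpredX ?memv_adjoin.
have root_za : root (minPoly K z) (z ^+ a).
  have [p Dp] : exists p : {poly rat}, minPoly K z = map_poly (in_alg L) p.
    have cf i : {c | (minPoly K z)`_i = c%:A}.
      by apply: sig_eqW; apply/vlineP; apply/polyOverP.
    exists (\poly_(i < size (minPoly K z)) sval (cf i)); apply/polyP => i.
    rewrite coef_map coef_poly; case: ltnP => [_|le_i]; last first.
      by rewrite nth_default //; apply/esym; apply: scale0r.
    by case: (cf i).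
  have Dip : map_poly iota (minPoly K z) = map_poly ratr p.
    rewrite Dp -map_poly_comp; apply: eq_map_poly => c /=.
    by rewrite alg_num_field fmorph_rat.
  have piz : m.-primitive_root (iota z) by rewrite fmorph_primitive_root.
  have [q [Dq _] dvq] := minCpolyP (iota z).
  have : root (map_poly ratr p) (iota z) by rewrite -Dip fmorph_root root_minPoly.
  rewrite dvq -(dvdp_map (@ratr algC)) -Dq -Dip.
  rewrite (minCpoly_cyclotomic piz) -(fmorph_root iota) => dvc.
  apply: (root_dvdp dvc); rewrite rmorphXn /= root_cyclotomic //.
  by rewrite prim_root_exp_coprime.
have sKE := subv_adjoin K z.
have /and3P[_ _ nKE] := galois_cyclotomic K pz.
have [s sG sz] := normalField_root_minPoly sKE nKE (memv_adjoin K z) root_za.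
by have := no s; rewrite sG sz eqxx.
Qed.

End NumberField.

Lemma ambient_field_exists (D m : nat) (w : algC) :
    m.-primitive_root w ->
  exists (L : splittingFieldType rat) (iota : {rmorphism L -> algC})
         (rD z : L), iota rD = sqrtC D%:R /\ iota z = w.
Proof.
move=> pw; have [Qn [QnC [[|rD [|z []]] // [DrD Dz] genQn]]] :=
  num_field_exists [:: sqrtC D%:R; w].
have pz : m.-primitive_root z by rewrite -Dz fmorph_primitive_root in pw.
have rD2 : rD ^+ 2 = D%:R.
  by apply: (fmorph_inj QnC); rewrite rmorphXn /= DrD sqrtCK rmorph_nat.
pose p : {poly Qn} := ('X^2 - D%:R%:P) * ('X^m - 1).
have Qn_ax : FieldExt_isSplittingField _ Qn.
  constructor; exists p.
    rewrite rpredM // rpredB ?rpred1 ?rpredX //= ?polyOverX //.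
    by rewrite polyOverC rpred_nat.
  pose r := codom (fun i : 'I_m => z ^+ i).
  have Dr : p = \prod_(y <- [:: rD, - rD & r]) ('X - y%:P).
    rewrite !big_cons big_image /= -(big_mkord xpredT (fun i => 'X - (z ^+ i)%:P)).
    by rewrite (factor_Xn_sub_1 pz) mulrA polyCN opprK -subr_sqr -polyC_exp rD2.
  exists [:: rD, - rD & r]; first by rewrite -Dr eqpxx.
  apply/eqP; rewrite eqEsubv subvf -genQn adjoin_seqSr //; apply/allP => /=.
  rewrite !inE eqxx /= andbT -[_ || _]/(z \in [:: rD, - rD & r]).
  rewrite -root_prod_XsubC -Dr rootM orbC.
  by apply/orP; left; apply/unity_rootP/prim_expr_order.
exists (HB.pack_for (splittingFieldType rat) Qn Qn_ax).
by exists QnC, rD, z.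
Qed.

(* Main.v *)
Require Import Defs.
From HB Require Import structures.
From mathcomp Require Import all_boot all_order all_algebra all_fingroup all_field.
Set Implicit Arguments.
Unset Strict Implicit.
Unset Printing Implicit Defensive.
Import Order.TTheory GRing.Theory Num.Theory.
Local Open Scope ring_scope.

(** The norm of [1 - z x] over [F] is [x ^ d * P(1/x)], where [P] is the minimal
    polynomial of [z] over [F] and [d] its degree. When [z] is a primitive root
    of unity of order [m l] and [F] contains [z ^ l], the roots of [X^l - z^l]
    are the [z ^ i] with [i = 1 (mod m)]. Those with [i] prime to [l] are
    conjugate to [z] over [K(z^l)] if [K] is linearly disjoint from [Q(z)]; when
    [l] is prime to [m] exactly one is left, [(z^l)^a] with [a l = 1 (mod m)],
    and it lies in [F]. In (i) the quadratic field may lie inside [Q(z)]; there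
    [X^l - z^l] is first seen to be irreducible over [Q(z^l)], and it remains
    so over [K(z^l)] because a degree at most 2 is prime to [l]. *)

(** * Norms from a Galois extension through minimal polynomials *)

Section GaloisNorm.

Variables (F0 : fieldType) (L : splittingFieldType F0).
Implicit Types (F E : {subfield L}) (x z : L).

(** The distinct conjugates of [z] number [[F(z) : F] = [E : F]], the order of the Galois group, so
    every automorphism yields exactly one root. *)
Lemma minPoly_galois F E z : galois F E -> <<F; z>>%VS = E ->
  minPoly F z = \prod_(s in 'Gal(E / F)%g) ('X - (s z)%:P).
Proof.
move=> galFE defE; have [sFE _ _] := and3P galFE.
have Ez : z \in E by rewrite -defE memv_adjoin.
have [r [/= sr Ur Dp]] := galois_factors sFE galFE z Ez.
have Ur' := map_uniq Ur; rewrite Dp big_map big_uniq //=; apply: eq_bigl.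
apply/subset_cardP => //; rewrite (card_uniqP Ur') -galois_dim //.
have <- : \dim_F <<F; z>>%VS = \dim_F E by rewrite defE.
by apply: succn_inj; rewrite -adjoin_degreeE -size_minPoly Dp size_prod_XsubC size_map.
Qed.

Lemma galNorm_1sub F E z x : galois F E -> <<F; z>>%VS = E -> x \in F -> x != 0 ->
  galNorm F E (1 - z * x) = x ^+ (size (minPoly F z)).-1 * (minPoly F z).[x^-1].
Proof.
move=> galFE defE Fx x0; have [sFE _ _] := and3P galFE.
rewrite size_minPoly /= adjoin_degreeE defE galois_dim // (minPoly_galois galFE) //.
rewrite horner_prod -prodr_const -big_split /=; apply: eq_bigr => s sG.
rewrite rmorphB rmorph1 rmorphM /= (fixed_gal sFE sG Fx) hornerXsubC.
by rewrite mulrBr divff // [x * _]mulrC.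
Qed.

End GaloisNorm.

(** * The roots of [X^l - z^l] *)

Section RadicalRoots.

Variables (R : fieldType) (l m : nat) (z : R).
Hypothesis prim_z : (m * l).-primitive_root z.

(** Such a [w] is an [m * l]-th root of unity, hence some [z ^+ i]; then [i * l = l] modulo [m * l],
    and [l] cancels. *)
Lemma radical_root_exp w :
  w ^+ l = z ^+ l -> exists2 i : nat, w = z ^+ i & i = 1 %[mod m].
Proof.
move=> wl; have ml0 := prim_order_gt0 prim_z.
have /(prim_rootP prim_z)[i Dw] : w ^+ (m * l) = 1.
  by rewrite mulnC exprM wl -exprM mulnC prim_expr_order.
exists i => //; move/eqP: wl; rewrite Dw -exprM (eq_prim_root_expr prim_z).
by rewrite -[X in _ == X %[mod _]]mul1n -!muln_modl eqn_pmul2r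
  ?(leq_trans _ (leq_pmull _ _)) // => [/eqP //|]; move: ml0; rewrite muln_gt0 => /andP[].
Qed.

Lemma dvdp_radical_eq (p : {poly R}) : p \is monic ->
    p %| 'X^l - (z ^+ l)%:P -> (forall w, w ^+ l = z ^+ l -> root p w) ->
  p = 'X^l - (z ^+ l)%:P.
Proof.
move=> mon_p dv_p rp; have [m0 l0] : (0 < m /\ 0 < l)%N.
  by apply/andP; rewrite -muln_gt0 (prim_order_gt0 prim_z).
have mon_q : 'X^l - (z ^+ l)%:P \is monic by rewrite monicXnsubC.
apply/eqP; rewrite -eqp_monic // -dvdp_size_eqp // eqn_leq dvdp_leq ?monic_neq0 //.
rewrite size_XnsubC //=.
(* These [l] distinct roots of [p] force its degree to be at least [l]. *)
pose rs := [seq z ^+ (1 + m * j) | j <- iota 0 l].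
rewrite -[l in (l < _)%N](size_iota 0) -(size_map (fun j => z ^+ (1 + m * j))).
apply: max_poly_roots; first exact: monic_neq0.
  apply/allP => _ /mapP[j _ ->]; apply: rp.
  by rewrite -exprM mulnDl exprD mul1n mulnAC exprM (prim_expr_order prim_z) expr1n mulr1.
rewrite map_inj_in_uniq ?iota_uniq // => i j; rewrite !mem_iota /= !add0n => il jl.
move/eqP; rewrite (eq_prim_root_expr prim_z) eqn_modDl -!muln_modr.
by rewrite eqn_pmul2l // !modn_small // => /eqP.
Qed.

End RadicalRoots.

(** * The minimal polynomial of [z] over [K(z^l)] *)

Section CyclotomicMinPoly.

Variables (L : splittingFieldType rat) (iota : {rmorphism L -> algC}).
Variables (l m : nat) (z : L).
Implicit Types K : {subfield L}.
Hypotheses (l_prime : prime l) (prim_z : (m * l).-primitive_root z).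

Lemma minPoly_dvd_radical K :
  minPoly <<K; z ^+ l>> z %| 'X^l - (z ^+ l)%:P.
Proof.
apply: minPoly_dvdp; last by rewrite /root !hornerE subrr.
by rewrite rpredB ?rpredX ?polyOverX // polyOverC memv_adjoin.
Qed.

(** The automorphism [z -> z ^+ a] over [K] also fixes [z ^+ l], because [a * l = l] modulo
    [m * l]. *)
Lemma root_minPoly_coprime_exp K (a : nat) :
    (K :&: <<1; z>>)%VS = 1%VS -> coprime a (m * l) -> a = 1 %[mod m] ->
  root (minPoly <<K; z ^+ l>> z) (z ^+ a).
Proof.
move=> capK co_a a1; have [sG sz] := cyc_autP iota prim_z co_a capK.
set s := cyc_aut K z a in sG sz; have sKE := subv_adjoin K z.
rewrite -sz; apply: (@root_minPoly_gal _ _ _ <<K; z>>%AS).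
- by apply/FadjoinP; rewrite subv_adjoin rpredX ?memv_adjoin.
- rewrite gal_kHom; last first.
    by apply/FadjoinP; rewrite subv_adjoin rpredX ?memv_adjoin.
  apply/kAHomP => _ /Fadjoin_polyP[p Kp ->].
  rewrite -horner_map /= (fixedPoly_gal sKE sG Kp) rmorphXn /= sz -!exprM.
  congr (_.[_]); apply/eqP; rewrite (eq_prim_root_expr prim_z).
  by rewrite -[X in _ == X %[mod _]]mul1n -!muln_modl a1.
exact: memv_adjoin.
Qed.

(** When [l] divides [m], an exponent congruent to 1 modulo [m] is automatically prime to [l], so
    all roots are conjugate. *)
Lemma minPoly_radical_ramified K : (l %| m)%N -> (K :&: <<1; z>>)%VS = 1%VS ->
  minPoly <<K; z ^+ l>> z = 'X^l - (z ^+ l)%:P.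
Proof.
move=> lm capK; apply: (dvdp_radical_eq prim_z); rewrite ?monic_minPoly //.
  exact: minPoly_dvd_radical.
move=> w /(radical_root_exp prim_z)[i -> i1].
apply: root_minPoly_coprime_exp => //.
have co_im : coprime i m by rewrite -coprime_modl i1 coprime_modl coprime1n.
by rewrite coprimeMr co_im (coprime_dvdr lm).
Qed.

Lemma minPoly_radical_unramified K (a : nat) :
    (a * l = 1 %[mod m])%N -> (K :&: <<1; z>>)%VS = 1%VS ->
  minPoly <<K; z ^+ l>> z * ('X - (z ^+ l ^+ a)%:P) = 'X^l - (z ^+ l)%:P.
Proof.
move=> al capK; set P := minPoly _ _; set c := z ^+ l ^+ a.
have Fzl : z ^+ l \in <<K; z ^+ l>>%VS by apply: memv_adjoin.
have cl : c ^+ l = z ^+ l.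
  rewrite /c -!exprM; apply/eqP; rewrite (eq_prim_root_expr prim_z) [(l * (a * l))%N]mulnC.
  by rewrite -[X in _ == X %[mod _]]mul1n -!muln_modl al.
apply: (dvdp_radical_eq prim_z); rewrite ?rpredM ?monic_minPoly ?monicXsubC //.
  rewrite Gauss_dvdp ?minPoly_dvd_radical //=; last first.
    (* If [c], which lies in the base field, were a root of the irreducible [P], then
       [z = c = z ^+ (l * a)], and comparing exponents modulo [l] gives [1 = 0]. *)
    rewrite coprimep_XsubC; apply/negP => Pc.
    have /(minPoly_irr _)/orP[||] : 'X - c%:P %| P by rewrite dvdp_XsubCl.
    - by rewrite polyOverXsubC rpredX.
    - move/eqp_root/(_ z); rewrite root_minPoly root_XsubC => /eqP.
      rewrite -[z in LHS]expr1 /c -exprM => /eqP.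
      rewrite (eq_prim_root_expr prim_z) => /eqP/(congr1 (modn^~ l)).
      rewrite !modn_dvdm ?dvdn_mull // modnMr modn_small ?prime_gt1 //.
    by rewrite -size_poly_eq1 size_XsubC.
  by rewrite dvdp_XsubCl /root !hornerE cl subrr.
move=> w /(radical_root_exp prim_z)[i -> i1]; rewrite rootM root_XsubC.
have co_im : coprime i m by rewrite -coprime_modl i1 coprime_modl coprime1n.
have [/dvdnP[j Di]|nl] := boolP (l %| i)%N.
  (* Modulo [m], [j = j * (a * l) = a * i = a], so this root is [c]. *)
  apply/orP; right; rewrite /c -exprM (eq_prim_root_expr prim_z) Di [(l * a)%N]mulnC.
  rewrite -!muln_modl eqn_pmul2r ?prime_gt0 //; apply/eqP.
  rewrite -[j in LHS]muln1 -modnMmr -al modnMmr mulnCA.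
  by rewrite -modnMmr -Di i1 modnMmr muln1.
apply/orP; left; apply: root_minPoly_coprime_exp => //.
by rewrite coprimeMr co_im coprime_sym prime_coprime.
Qed.

Lemma adjoin_exp K n : <<<<K; z ^+ n>>; z>>%VS = <<K; z>>%VS.
Proof.
apply/eqP; rewrite eqEsubv; apply/andP; split; last first.
  by rewrite adjoinSl ?subv_adjoin.
apply/FadjoinP; split; last exact: memv_adjoin.
by apply/FadjoinP; rewrite subv_adjoin rpredX ?memv_adjoin.
Qed.

(* Multiplicativity of degrees gives [F(z) : F] [Q0(x) : Q0] = l [Q1(x) : Q1]. *)
Lemma minPoly_radical_small_degree x : (l %| m)%N -> (adjoin_degree 1 x < l)%N ->
  minPoly <<<<1; x>>; z ^+ l>> z = 'X^l - (z ^+ l)%:P.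
Proof.
move=> lm ltxl; set Q0 := <<1; z ^+ l>>%AS; set Q1 := <<1; z>>%AS.
have l0 := prime_gt0 l_prime.
have dQ1 : \dim Q1 = (l * \dim Q0)%N.
  (* Over the rationals the disjointness condition is trivial. *)
  have PQ := minPoly_radical_ramified lm (capv_idPl (sub1v <<1; z>>)).
  rewrite /Q1 /= -(adjoin_exp _ l) dim_Fadjoin; congr (_ * _)%N.
  by apply: succn_inj; rewrite -size_minPoly PQ size_XnsubC.
set F := <<<<1; x>>; z ^+ l>>%AS.
have dF : \dim F = (adjoin_degree Q0 x * \dim Q0)%N.
  by rewrite -dim_Fadjoin /F /= adjoinC.
have : (adjoin_degree F z * \dim F = adjoin_degree Q1 x * \dim Q1)%N.
  by rewrite -!dim_Fadjoin /F /= adjoin_exp adjoinC.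
rewrite dF dQ1 !mulnA => /eqP; rewrite eqn_pmul2r ?adim_gt0 // => /eqP dd.
(* [[Q0(x) : Q0]] is at most [[Q(x) : Q] < l], hence prime to [l]. *)
have lF : (l %| adjoin_degree F z)%N.
  rewrite -(@Gauss_dvdl _ _ (adjoin_degree Q0 x)) ?dd ?dvdn_mull //.
  rewrite prime_coprime // gtnNdvd //.
  rewrite -ltnS -size_minPoly (leq_ltn_trans _ (_ : size (minPoly 1 x) < l.+1)%N) //.
    by rewrite dvdp_leq ?monic_neq0 ?monic_minPoly // minPolyS ?sub1v.
  by rewrite size_minPoly ltnS.
apply/eqP; rewrite -eqp_monic ?monic_minPoly ?monicXnsubC //.
rewrite -dvdp_size_eqp ?minPoly_dvd_radical // eqn_leq.
rewrite dvdp_leq ?minPoly_dvd_radical ?monic_neq0 ?monicXnsubC //=.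
by rewrite size_XnsubC // size_minPoly ltnS dvdn_leq.
Qed.

End CyclotomicMinPoly.


Lemma Cyclotomic_prime (l : nat) : prime l -> 'Phi_l * ('X - 1) = 'X^l - 1.
Proof.
move=> l_prime; have l0 := prime_gt0 l_prime.
have divl : perm_eq (divisors l) [:: l; 1%N].
  apply: uniq_perm; first exact: divisors_uniq.
    by rewrite /= inE neq_ltn prime_gt1 // orbT.
  move=> d; rewrite -dvdn_divisors // !inE orbC.
  apply/idP/orP=> [|[]/eqP ->]; rewrite ?dvd1n ?dvdnn //.
  by case/primeP: l_prime => _ /[apply] /orP.
rewrite -(prod_Cyclotomic l0) (perm_big _ divl) big_cons big_seq1 /=.
have := @prod_Cyclotomic 1 isT; rewrite (_ : divisors 1 = [:: 1%N]) // big_seq1.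
by rewrite expr1 => ->.
Qed.

(** * The norm relations *)

Theorem corollary1p3
  (D : nat) (D_gt1 : (1 < D)%N) (D_sqf : square_free D)
  (zeta : nat -> algC) (zetaP : compatible_roots zeta)
  (L : splittingFieldType rat) (iota : {rmorphism L -> algC})
  (rD : L) (rDP : iota rD = sqrtC D%:R)
  (u : L) (uP : fundamental_unit iota <<1; rD>>%AS u)
  (l : nat) (l_prime : prime l) (k : nat) :
  let K : {subfield L} := <<1; rD>>%AS in
  let eps : L := positive_norm_unit K u in
  (odd l ->
   forall s : nat, (0 < s)%N ->
   forall z1 z0 : L, iota z1 = zeta (l ^ s.+1)%N -> iota z0 = zeta (l ^ s)%N ->
   galNorm <<K; z0>> <<K; z1>> (cyc z1 eps k) = cyc z0 eps (l * k))
  /\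
  (forall m : nat, (0 < m)%N -> coprime m l ->
   forall zml zm : L, iota zml = zeta (m * l)%N -> iota zm = zeta m ->
   (K :&: <<1; zml>>)%VS = 1%VS ->
   ((1 < m)%N -> forall a : nat, (a * l = 1 %[mod m])%N ->
    galNorm <<K; zm>> <<K; zml>> (cyc zml eps k) =
      cyc zm eps (l * k) / cyc_aut K zm a (cyc zm eps k))
   /\
   (m = 1%N ->
    galNorm K <<K; zml>> (cyc zml eps k) =
      (map_poly intr 'Phi_l : {poly L}).[eps ^+ k]
    /\
    ((0 < k)%N ->
     galNorm K <<K; zml>> (cyc zml eps k) =
       cyc zm eps (l * k) / cyc zm eps k))).
Proof.
move=> K eps; case: zetaP => prim_zeta zetaX.
have [[Ku u0 _ _] u_gt1 _] := uP.
have Keps : eps \in K by rewrite /eps /positive_norm_unit; case: ifP; rewrite ?rpredX.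
have eps_gt1 : 1 < iota eps.
  by rewrite /eps /positive_norm_unit; case: ifP; rewrite // rmorphXn exprn_egt1.
set x := eps ^+ k; have Kx : x \in K by apply: rpredX.
have eps0 : eps != 0 by rewrite -(fmorph_eq0 iota) gt_eqF // (lt_trans ltr01).
have x0 : x != 0 by rewrite expf_neq0.
have l0 := prime_gt0 l_prime.
split=> [l_odd s s_gt0 z1 z0 Dz1 Dz0 | m m0 co_ml zml zm Dzml Dzm capK].
  have pz1 : (l ^ s * l).-primitive_root z1.
    by rewrite -expnSr -(fmorph_primitive_root iota) Dz1 prim_zeta // expn_gt0 l0.
  have ->: z0 = z1 ^+ l.
    apply: (fmorph_inj iota); rewrite rmorphXn /= Dz0 Dz1 expnSr zetaX //.
    by rewrite expn_gt0 l0.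
  have P1 : minPoly <<K; z1 ^+ l>> z1 = 'X^l - (z1 ^+ l)%:P.
    apply: (minPoly_radical_small_degree iota l_prime pz1).
      exact: dvdn_exp s_gt0 (dvdnn l).
    (* Oddness of [l] enters here: [K] has degree at most 2, which is less than [l]. *)
    apply: (@leq_ltn_trans 2); last by rewrite odd_prime_gt2.
    have : minPoly 1 rD %| 'X^2 - (rD ^+ 2)%:P.
      apply: minPoly_dvdp; last by rewrite /root !hornerE subrr.
      have -> : rD ^+ 2 = D%:R.
        by apply: (fmorph_inj iota); rewrite rmorphXn /= rDP sqrtCK rmorph_nat.
      by rewrite rpredB ?rpredX ?polyOverX // polyOverC rpred_nat.
    move/dvdp_leq; rewrite monic_neq0 ?monicXnsubC // => /(_ isT).
    by rewrite size_minPoly size_XnsubC.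
  have galE := galois_cyclotomic_tower iota K l pz1.
  rewrite /cyc (galNorm_1sub galE (adjoin_exp z1 K l) (subvP_adjoin _ Kx) x0).
  rewrite P1 size_XnsubC //= !hornerE mulrBr exprVn divff ?expf_neq0 //.
  by rewrite [x ^+ l * _]mulrC /x -exprM [(k * l)%N]mulnC.
have pz : (m * l).-primitive_root zml.
  by rewrite -(fmorph_primitive_root iota) Dzml prim_zeta // muln_gt0 m0.
have Dz : zm = zml ^+ l.
  by apply: (fmorph_inj iota); rewrite rmorphXn /= Dzm Dzml zetaX.
have pzm : m.-primitive_root zm.
  by rewrite -(fmorph_primitive_root iota) Dzm prim_zeta.
(* The product form stays valid when [m = 1] and [k = 0], where the second factor vanishes. *)
have norm_eq (a : nat) : (a * l = 1 %[mod m])%N ->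
  galNorm <<K; zm>> <<K; zml>> (cyc zml eps k) * (1 - zm ^+ a * x) =
     cyc zm eps (l * k).
  move=> al; have Pm := minPoly_radical_unramified iota l_prime pz al capK.
  rewrite -Dz in Pm.
  have galE := galois_cyclotomic_tower iota K l pz.
  rewrite Dz /cyc (galNorm_1sub galE (adjoin_exp zml K l) (subvP_adjoin _ Kx) x0).
  rewrite -Dz; have szP : (size (minPoly <<K; zm>> zml)) = l.
    have := congr1 (fun p : {poly L} => size p) Pm.
    by rewrite size_Mmonic ?monicXsubC ?monic_neq0 ?monic_minPoly // size_XsubC
       size_XnsubC // addn2 => -[].
  rewrite szP; transitivity (x ^+ l * ('X^l - zm%:P).[x^-1]).
    (* The minimal polynomial has degree [l - 1]; the leftover root supplies the last factor [x]. *)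
    have -> : 1 - zm ^+ a * x = x * (x^-1 - zm ^+ a).
      by rewrite mulrBr divff // [x * _]mulrC.
    by rewrite -Pm hornerM hornerXsubC mulrACA -exprSr prednK.
  rewrite !hornerE mulrBr exprVn divff ?expf_neq0 //.
  by rewrite [x ^+ l * _]mulrC /x -exprM [(k * l)%N]mulnC.
(* If it vanished, its [m]-th power would give [eps ^+ (k * m) = 1]; as [iota eps > 1], this forces
   [k = 0], and then [m] divides [a]. *)
have cyc_neq0 (a : nat) : (0 < k)%N || ~~ (m %| a)%N -> 1 - zm ^+ a * x != 0.
  move=> k_or_a; rewrite subr_eq0; apply: contraL k_or_a => /eqP ax.
  have xm : iota eps ^+ (k * m) = 1.
    rewrite -rmorphXn exprM -/x; apply/eqP; rewrite fmorph_eq1.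
    have := congr1 (fun y => y ^+ m) ax.
    by rewrite expr1n exprMn exprAC (prim_expr_order pzm) expr1n mul1r => <-.
  have k0 : k = 0%N.
    apply/eqP; have := negbT (gt_eqF eps_gt1); apply: contraR => k_n0.
    rewrite -(@pexpr_eq1 _ _ (k * m)) ?xm ?eqxx ?muln_gt0 ?lt0n ?k_n0 -?lt0n //.
    by rewrite ltW // (lt_trans ltr01).
  by rewrite k0 /= negbK (prim_order_dvd pzm) ax /x k0 expr0 mulr1.
split=> [m_gt1 a al | m1].
  have co_am : coprime a m.
    have : coprime (a * l) m by rewrite -coprime_modl al coprime_modl coprime1n.
    by rewrite coprimeMl => /andP[].
  have capm : (K :&: <<1; zm>>)%VS = 1%VS.
    apply/eqP; rewrite eqEsubv subv_cap !sub1v /= -[X in (_ <= X)%VS]capK andbT.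
    apply: capvS => //; apply/FadjoinP.
    by rewrite sub1v Dz rpredX ?memv_adjoin.
  have [sG sz] := cyc_autP iota pzm co_am capm.
  have -> : cyc_aut K zm a (cyc zm eps k) = 1 - zm ^+ a * x.
    rewrite rmorphB rmorph1 rmorphM /= sz.
    by rewrite (fixed_gal (subv_adjoin K zm) sG Kx).
  rewrite -(norm_eq _ al) mulfK // cyc_neq0 //; apply/orP; right.
  apply: contraL co_am => /dvdnP[b ->].
  by rewrite /coprime gcdnC gcdnMl neq_ltn m_gt1 orbT.
have zm1 : zm = 1 by have := prim_expr_order pzm; rewrite m1 expr1.
have defK : <<K; zm>>%VS = K by apply/Fadjoin_idP; rewrite zm1 mem1v.
(* Modulo 1, [0] serves as the inverse of [l]; the extra factor becomes [1 - x]. *)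
have al : (0 * l = 1 %[mod m])%N by rewrite m1 !modn1.
have := norm_eq _ al; rewrite defK zm1 expr1n mul1r => normE.
have xn1 : (0 < k)%N -> 1 - x != 0.
  by move=> k0; have := cyc_neq0 0%N; rewrite k0 expr0 mul1r; apply.
have Phi1 : map_poly intr 'Phi_l * ('X - 1) = 'X^l - 1 :> {poly L}.
  have := congr1 (map_poly (intr : int -> L)) (Cyclotomic_prime l_prime).
  by rewrite rmorphM !rmorphB /= map_polyX map_polyXn !rmorph1.
split=> [|k0]; last by rewrite -normE /cyc -/x mul1r mulfK ?xn1.
have [k0|k0] := posnP k; last first.
  apply: (mulIf (xn1 k0)); rewrite normE.
  have := congr1 (fun p : {poly L} => - p.[x]) Phi1.
  by rewrite !hornerE -mulrN !opprB /cyc mul1r => ->; rewrite /x -exprM mulnC.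
(* For [k = 0] the factor [1 - x] is zero, so [X - 1] is cancelled between polynomials instead: the
   minimal polynomial is ['Phi_l], evaluated at 1. *)
have := minPoly_radical_unramified iota l_prime pz al capK.
rewrite /= -Dz defK zm1 expr1n -Phi1 => /(mulIf _) PhiE.
have galE := galois_cyclotomic iota K pz.
rewrite /cyc -/x (galNorm_1sub galE (erefl _) Kx x0) /x k0 expr0 expr1n invr1 mul1r.
by rewrite PhiE // polyXsubC_eq0.
Qed.
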